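(* Let $G=(V,p,\mu)$ be a weighted graph with bounded geometry, with ellipticity constant $\alpha>0$, satisfying $CD(K,\infty)$ with $K\ge 0$. Let $u_0\in L^\infty(V,\mu)$ be such that $\|\Gamma u_0\|_\infty<\alpha/2$. Then there exists a unique solution $u:[0,\infty)\to L^\infty(V,\mu)$ of the modified heat equation $$\frac{\partial u}{\partial t}=\Delta u+\Gamma u$$ such that $u(0)=u_0$. Moreover, for all $t\ge 0$, $$\|\Gamma u(t)\|_\infty\le e^{-2Kt}\,\|\Gamma u_0\|_\infty .$$
   Context: Weighted graph: a triple $G=(V,p,\mu)$ where $V$ is a countable (finite or infinite) set, $p:V\times V\to[0,\infty)$, $\mu:V\to(0,\infty)$. Write $x\sim y$ if $p(x,y)>0$. It is required that each $x$ has finitely many neighbors, that $p$ is a Markov kernel ($\sum_{y\sim x}p(x,y)=1$ for every $x$), and that $G$ is connected (any two vertices are joined by a finite path $x_0,\dots,x_N$ with $x_i\sim x_{i+1}$). Bounded geometry: (i) there is $\alpha>0$ with $p(x,y)\ge\alpha$ whenever $x\sim y$ (ellipticity constant $\alpha$); (ii) reversibility: $p(x,y)\mu(x)=p(y,x)\mu(y)$ for all $x,y$. $L^\infty(V,\mu)$ is the space of bounded real functions on $V$ with the sup norm $\|\cdot\|_\infty$. Operators on functions $f,g:V\to\mathbb{R}$: $\Delta f(x)=\sum_{y\sim x}p(x,y)(f(y)-f(x))$; $\Gamma(f,g)=\frac12(\Delta(fg)-f\Delta g-g\Delta f)$, $\Gamma f=\Gamma(f,f)$, i.e. $\Gamma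 f(x)=\frac12\sum_{y\sim x}p(x,y)(f(x)-f(y))^2$; $\Gamma_2 f=\frac12\Delta(\Gamma f)-\Gamma(f,\Delta f)$. $G$ satisfies $CD(K,\infty)$ if $\Gamma_2 f\ge K\,\Gamma f$ pointwise on $V$ for all functions $f:V\to\mathbb{R}$. A solution of the modified heat equation on $[0,\infty)$ with values in $L^\infty(V,\mu)$ is a map $u:[0,\infty)\to L^\infty(V,\mu)$, continuous on $[0,\infty)$ and $C^1$ on $(0,\infty)$ for the norm topology, with $\frac{du}{dt}(t)=\Delta u(t)+\Gamma u(t)$ for all $t>0$. *)

(* Defs.v *)
From HB Require Import structures.
From mathcomp Require Import all_boot all_order all_algebra.
From mathcomp Require Import all_classical all_reals all_analysis.
From mathcomp Require Import ring.

Set Implicit Arguments.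
Unset Strict Implicit.
Unset Printing Implicit Defensive.
Import Order.TTheory GRing.Theory Num.Theory.
Import numFieldNormedType.Exports.

Local Open Scope classical_set_scope.
Local Open Scope ring_scope.

(* [linfty V R] stands for L^oo(V, mu): the weight mu is everywhere positive, so
   the essential supremum with respect to mu is the supremum, and functions
   equal mu-almost everywhere are equal. *)
Definition boundedf {T : Type} {R : realType} : {pred T -> R} :=
  mem [set f : T -> R | [bounded f x | x in [set: T]]].

Lemma boundedfP {T : Type} {R : realType} (f : T -> R) :
  f \in boundedf <-> exists M, forall x, `|f x| <= M.
Proof.
rewrite /boundedf inE; split=> [[M [_ fM]]|[M fM]].
  by exists (M + 1) => x; apply: fM => //; rewrite ltrDl.
exists M; split; first exact: num_real.
by move=> N MN x _; exact: le_trans (fM x) (ltW MN).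
Qed.

Lemma boundedf_submod_closed {T : Type} {R : realType} :
  submod_closed (@boundedf T R).
Proof.
split; first by apply/boundedfP; exists 0 => x; rewrite normr0.
move=> a f g /boundedfP[M fM] /boundedfP[N gN]; apply/boundedfP.
exists (`|a| * M + N) => x; rewrite (le_trans (ler_normD _ _))// lerD//.
by rewrite normrM ler_wpM2l.
Qed.

HB.instance Definition _ (T : Type) (R : realType) :=
  GRing.isSubmodClosed.Build R (T -> R) (@boundedf T R) boundedf_submod_closed.

Record linfty (T : Type) (R : realType) :=
  Linfty { linfty_fun :> T -> R ; linftyP : linfty_fun \in boundedf }.

HB.instance Definition _ (T : Type) (R : realType) :=
  [isSub for @linfty_fun T R].
HB.instance Definition _ (T : Type) (R : realType) :=
  [Choice of linfty T R by <:].
HB.instance Definition _ (T : Type) (R : realType) :=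
  [SubChoice_isSubLmodule of linfty T R by <:].

(* [sup set0 = 0], so that this is a norm when [T] is empty too. *)
Definition supnorm {T : Type} {R : realType} (f : T -> R) : R :=
  sup (range (fun x => `|f x|)).

Lemma supnorm_ge {T : Type} {R : realType} (f : linfty T R) x :
  `|f x| <= supnorm f.
Proof.
have [M fM] := (boundedfP f).1 (linftyP f).
apply: sup_upper_bound; last by exists x.
by split; [exists `|f x|; exists x | exists M => _ [y _ <-]].
Qed.

Lemma supnorm_le {T : Type} {R : realType} (f : T -> R) M :
  0 <= M -> (forall x, `|f x| <= M) -> supnorm f <= M.
Proof.
move=> M0 fM; rewrite /supnorm.
have [->|/set0P ne] := eqVneq (range (fun x => `|f x|)) set0.
  by rewrite sup0.
by apply: ge_sup => // _ [y _ <-].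
Qed.

Lemma supnorm_ge0 {T : Type} {R : realType} (f : linfty T R) :
  0 <= supnorm f.
Proof.
rewrite /supnorm.
have [->|/set0P[_ [x _ _]]] := eqVneq (range (fun x => `|f x|)) set0.
  by rewrite sup0.
exact: le_trans (normr_ge0 (f x)) (supnorm_ge f x).
Qed.

Section linfty_normed.
Context (T : Type) (R : realType).
Implicit Types f g : linfty T R.

Lemma supnormD f g :
  supnorm (f + g : linfty T R) <= supnorm f + supnorm g.
Proof.
apply: supnorm_le => [|x]; first by rewrite addr_ge0 ?supnorm_ge0.
by rewrite (le_trans (ler_normD _ _))// lerD// supnorm_ge.
Qed.

Lemma supnormZ a f : supnorm (a *: f : linfty T R) = `|a| * supnorm f.
Proof.
have leZ b g : supnorm (b *: g : linfty T R) <= `|b| * supnorm g.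
  apply: supnorm_le => [|x]; first by rewrite mulr_ge0 ?supnorm_ge0.
  by rewrite normrM ler_wpM2l// supnorm_ge.
apply/eqP; rewrite eq_le leZ andTb.
have [->|a0] := eqVneq a 0.
  by rewrite normr0 mul0r; exact: supnorm_ge0.
rewrite -ler_pdivlMl ?normr_gt0// -normfV.
by have := leZ a^-1 (a *: f); rewrite scalerA mulVf// scale1r.
Qed.

Lemma supnorm_eq0 f : supnorm f = 0 -> f = 0.
Proof.
move=> f0; apply/val_inj/funext => x; apply/eqP.
by rewrite -normr_le0 -f0 supnorm_ge.
Qed.

HB.instance Definition _ :=
  Lmodule_isNormed.Build R (linfty T R) supnormD supnormZ supnorm_eq0.

End linfty_normed.

Record weightedGraph (R : realType) := WeightedGraph {
  vertex :> countType ;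
  kernel : vertex -> vertex -> R ;
  weight : vertex -> R ;
  adj : rel vertex := fun x y => 0 < kernel x y ;
  nbr : vertex -> set vertex := fun x => [set y | adj x y] ;
  kernel_ge0 : forall x y, 0 <= kernel x y ;
  weight_gt0 : forall x, 0 < weight x ;
  nbr_finite : forall x, finite_set (nbr x) ;
  kernel_markov : forall x, \sum_(y \in nbr x) kernel x y = 1 ;
  graph_connected : forall x y, exists2 s, path adj x s & last x s = y
}.

Definition bounded_geometry {R : realType} (G : weightedGraph R) (alpha : R) :=
  [/\ 0 < alpha,
      (forall x y : G, adj x y -> alpha <= kernel x y) &
      (forall x y : G, kernel x y * weight x = kernel y x * weight y)].

Section operators.
Context {R : realType} {G : weightedGraph R}.
Implicit Types f g : G -> R.

Definition Delta f : G -> R :=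
  fun x => \sum_(y \in nbr x) kernel x y * (f y - f x).

Definition Gamma f g : G -> R :=
  fun x => 2^-1 * (Delta (f \* g) x - f x * Delta g x - g x * Delta f x).

Definition Gamma2 f : G -> R :=
  fun x => 2^-1 * Delta (Gamma f f) x - Gamma f (Delta f) x.

Lemma Delta_bounded f : f \in boundedf -> Delta f \in boundedf.
Proof.
move=> /boundedfP[M fM]; apply/boundedfP; exists (M + M) => x.
rewrite /Delta fsbig_finite; last exact: nbr_finite.
rewrite (le_trans (ler_norm_sum _ _ _))//.
rewrite -[leRHS]mul1r -(kernel_markov x) fsbig_finite; last exact: nbr_finite.
rewrite mulr_suml ler_sum// => y _.
rewrite normrM (ger0_norm (kernel_ge0 _ _)) ler_wpM2l ?kernel_ge0//.
by rewrite (le_trans (ler_normB _ _))// lerD.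
Qed.

Lemma boundedfM f g : f \in boundedf -> g \in boundedf -> f \* g \in boundedf.
Proof.
move=> /boundedfP[M fM] /boundedfP[N gN]; apply/boundedfP; exists (M * N) => x.
by rewrite /= normrM ler_pM.
Qed.

Lemma Gamma_bounded f g :
  f \in boundedf -> g \in boundedf -> Gamma f g \in boundedf.
Proof.
move=> fb gb.
rewrite (_ : Gamma f g =
  2^-1 *: (Delta (f \* g) - f \* Delta g - g \* Delta f))//.
by rewrite rpredZ// !rpredB// ?Delta_bounded ?boundedfM ?Delta_bounded.
Qed.

Definition linfty_Delta (f : linfty G R) : linfty G R :=
  Linfty (Delta_bounded (linftyP f)).

Definition linfty_Gamma (f : linfty G R) : linfty G R :=
  Linfty (Gamma_bounded (linftyP f) (linftyP f)).

End operators.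

Definition CD_infty {R : realType} (G : weightedGraph R) (K : R) :=
  forall (f : G -> R) (x : G), K * Gamma f f x <= Gamma2 f x.

(* A map on [0, +oo[ is represented by a total function on [R] whose values on
   negative reals are irrelevant. *)
Definition modified_heat_solution {R : realType} (G : weightedGraph R)
    (u : R -> linfty G R) :=
  [/\ {within `[0, +oo[, continuous u},
      (forall t : R, 0 < t -> derivable u t 1),
      {within `]0, +oo[, continuous (derive1 u)} &
      (forall t : R, 0 < t ->
         derive1 u t = linfty_Delta (u t) + linfty_Gamma (u t))].

Lemma linfty_normE {T : Type} {R : realType} (f : linfty T R) :
  `|f| = sup (range (fun x => `|f x|)).
Proof. by []. Qed.

Lemma GammaE {R : realType} (G : weightedGraph R) (f : G -> R) x :
  Gamma f f x = 2^-1 * \sum_(y \in nbr x) kernel x y * (f x - f y) ^+ 2.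
Proof.
rewrite /Gamma /Delta; congr (_ * _).
rewrite !fsbig_finite; try exact: nbr_finite.
rewrite !mulr_sumr -!sumrB; apply: eq_bigr => y _ /=.
rewrite -!mulNr; ring.
Qed.

(* Main.v *)
Require Import Defs.
From HB Require Import structures.
From mathcomp Require Import all_boot all_order all_algebra.
From mathcomp Require Import all_classical all_reals all_analysis.
From mathcomp Require Import finmap ring lra.
Import Order.TTheory GRing.Theory Num.Theory.
Import numFieldNormedType.Exports.
Local Open Scope ring_scope.

(** Everything rests on one observation: if Gamma u < alpha / 2 everywhere then
    |u y - u x| <= 1 along every edge, because a single edge contributes at
    least alpha / 2 * (u y - u x)^2 to Gamma u x ([increment_le1]).

    Gradient bound. Put g = Gamma u. Along the equation,
    dg/dt = 2 Gamma(u, Delta u + g), and CD(K, oo) bounds the part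
    2 Gamma(u, Delta u) by Delta g - 2 K g. What is left,
    Delta g + 2 Gamma(u, g), is at x the average over the neighbours y of
    (1 + u y - u x) * (g y - g x); as long as Gamma u < alpha / 2 the weights
    1 + u y - u x are nonnegative, so this is a (not self-adjoint) diffusion
    operator applied to g, and the maximum principle says that sup g decays at
    rate 2 K ([Gamma_max_principle]). The supremum of g need not be attained
    when V is infinite, so the principle is applied to finite increments of
    time: |Gamma u(t + h)| <= (1 - 2 K h) |Gamma u(t)| + o(h)
    ([Gamma_flow_dini]). A barrier argument integrates such one-sided
    inequalities even when they are only known while the quantity stays below a
    threshold ([exp_bound_of_dini]); since K >= 0, the threshold alpha / 2 is
    never reached ([Gamma_flow_decay]). This applies to every solution with the
    given initial value.

    Existence. Delta u + Gamma u is the average of d + d^2 / 2 over the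
    increments d = u y - u x. Clipping d to [-1, 1] gives a bounded, globally
    Lipschitz vector field ([clipped_generator_lip]), hence a global flow
    ([clipped_flow_exists]). Wherever Gamma u < alpha / 2 the clipped field is
    the original one, so the gradient bound applies to this flow and shows that
    the clipping is never active: the flow solves the original equation.

    Uniqueness. Any solution obeys the gradient bound, hence is also an integral
    curve of the clipped field, and a Lipschitz field has only one such curve
    ([clipped_flow_unique]). *)

Local Open Scope classical_set_scope.

(** * Primitives, mean values and geometric convergence on the real line *)

(** The base point [a] of the integral lies strictly before [c], so that [F] has
    a two-sided derivative at [c] itself and not only to its right. *)
Lemma primitive_after (R : realType) (f : R -> R) (a c : R) :
  continuous f -> a < c ->
  exists F : R -> R, F c = 0 /\ forall t, a < t -> is_derive t 1 F (f t).
Proof.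
move=> cf ac.
pose I t := (\int[lebesgue_measure]_(s in [set` `[a, t]]) f s)%R.
exists (fun t => I t - I c); split; first by rewrite subrr.
move=> t at_.
have fi : lebesgue_measure.-integrable `[a, t + 1] (EFin \o f).
  apply: continuous_compact_integrable; first exact: segment_compact.
  exact: continuous_subspaceT.
have tt : t < t + 1 by rewrite ltrDl.
have [dI I'] := continuous_FTC1_closed tt fi at_ (cf t).
rewrite -[f t]subr0; apply: is_deriveB.
by apply: (DeriveDef dI); rewrite -derive1E; exact: I'.
Qed.

(** Mean value inequality against a majorant [g]: for every [k] with [|k| <= 1]
    the function [g - k f] is nondecreasing; [k = 1] and [k = -1] suffice. *)
Lemma mean_value_le (R : realType) (f g df dg : R -> R) (a b : R) :
  a <= b ->
  (forall s, a <= s <= b -> is_derive s 1 f (df s)) ->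
  (forall s, a <= s <= b -> is_derive s 1 g (dg s)) ->
  (forall s, a <= s <= b -> `|df s| <= dg s) ->
  `|f b - f a| <= g b - g a.
Proof.
move=> ab fD gD fg.
have main (k : R) : `|k| <= 1 -> 0 <= g b - g a - k * (f b - f a).
  move=> k1.
  have hD s : a <= s <= b ->
      is_derive s 1 (fun s => g s - k * f s) (dg s - k * df s).
    move=> sab; apply: is_deriveB; first exact: gD.
    by have := fD s sab => ?; exact: is_deriveZ.
  have hc : {within `[a, b], continuous (fun s => g s - k * f s)}.
    apply: derivable_within_continuous => s; rewrite in_itv /= => sab.
    by case: (hD s sab).
  have hd s : s \in `]a, b[%R ->
      is_derive s 1 (fun s => g s - k * f s) (dg s - k * df s).
    by rewrite in_itv /= => /andP[/ltW ? /ltW ?]; apply: hD; apply/andP.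
  have [s sab E] := MVT_segment ab hd hc.
  have -> : g b - g a - k * (f b - f a) = (dg s - k * df s) * (b - a).
      by rewrite -E; ring.
    rewrite mulr_ge0 ?subr_ge0 // -(mul1r (dg s)).
    rewrite (le_trans (ler_norm _)) // normrM.
    by rewrite ler_pM // fg //; move: sab; rewrite in_itv.
rewrite ler_norml; have := main 1; have := main (-1).
rewrite normrN normr1 => /(_ (lexx _)) h1 /(_ (lexx _)) h2; lra.
Qed.

Lemma max0_contract (R : realType) (s t : R) :
  `|Num.max 0 s - Num.max 0 t| <= `|s - t|.
Proof.
case: (leP 0 s); case: (leP 0 t) => ? ?;
  rewrite ?subrr ?normr0 ?subr0 ?sub0r //.
  by rewrite !ger0_norm; lra.
by rewrite normrN distrC !ger0_norm; lra.
Qed.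

(** The intervals of radius [2 C / 2^n] around [a n] are nested, so the
    supremum of their left ends lies in all of them. *)
Lemma cauchy_geometric (R : realType) (a : nat -> R) (C : R) :
  (forall n, `|a n.+1 - a n| <= C * 2^-1 ^+ n) ->
  exists l, forall n, `|l - a n| <= 2 * C * 2^-1 ^+ n.
Proof.
move=> ha.
pose lo n := a n - 2 * C * 2^-1 ^+ n; pose hi n := a n + 2 * C * 2^-1 ^+ n.
have C0 n : 0 <= C * 2^-1 ^+ n by exact: le_trans (normr_ge0 _) (ha n).
have loS n : lo n <= lo n.+1.
  by have := ha n; rewrite /lo exprS ler_norml => /andP[? ?]; nra.
have hiS n : hi n.+1 <= hi n.
  by have := ha n; rewrite /hi exprS ler_norml => /andP[? ?]; nra.
have lole n m : (n <= m)%N -> lo n <= lo m.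
  by apply: (@homo_leq _ lo <=%R) => //; exact: le_trans.
have hile n m : (n <= m)%N -> hi m <= hi n.
  apply: (@homo_leq _ hi (fun x y => y <= x)) => //.
  by move=> x y z xy /le_trans; apply.
have lohi n m : lo n <= hi m.
  apply: le_trans (lole n (maxn n m) (leq_maxl _ _)) _.
  apply: le_trans (hile m (maxn n m) (leq_maxr _ _)).
  by rewrite /lo /hi; have := C0 (maxn n m); nra.
exists (sup (range lo)) => n.
have h1 : lo n <= sup (range lo).
  apply: ub_le_sup; last by exists n.
  by exists (hi 0%N) => _ [m _ <-].
have h2 : sup (range lo) <= hi n.
  by apply: ge_sup; [exists (lo 0%N); exists 0%N|move=> _ [m _ <-]].
by rewrite ler_distlC /lo /hi in h1 h2 *; apply/andP; split; lra.
Qed.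

Lemma le_add_geometric (R : realType) (x y C : R) :
  (forall n, x <= y + C * 2^-1 ^+ n) -> x <= y.
Proof.
move=> h; have lim : y + C * 2^-1 ^+ n @[n --> \oo] --> y + C * 0.
  apply: cvgD; first exact: cvg_cst.
  by apply: cvgMr; apply: cvg_expr; rewrite ger0_norm; lra.
have : x <= y + C * 0 by apply: (cvgr_to_ge lim); apply: nearW.
by rewrite mulr0 addr0.
Qed.

(** * One-sided differential inequalities *)

(** Dini's monotonicity criterion, with a threshold: the differential
    inequality is only assumed while [f < c]. For a small slope [eps], consider
    the times up to which [f] stays below the barrier [f s + eps (r - s)]. By
    continuity their supremum [t] is one of them; the barrier is itself below
    [c], so the hypothesis applies at [t] and pushes the bound past [t], unless
    [t] is already the final time. *)
Lemma nonincreasing_of_dini (R : realType) (f : R -> R) (c s T : R) :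
  (forall t, s < t -> {for t, continuous f}) ->
  (forall t, s <= t -> f t < c -> forall eps, 0 < eps ->
     \forall h \near 0^'+, f (t + h) <= f t + eps * h) ->
  f s < c -> s <= T -> f T <= f s.
Proof.
move=> cf df fsc sT; apply/ler_addgt0Pr => e e0.
(* A slope so small that the barrier stays below [c] and rises by at most
   [e] up to time [T]. *)
have [eps [eps0 epsc epse]] : exists eps, [/\ 0 < eps,
    eps * (T - s) < c - f s & eps * (T - s) <= e].
  pose m := Num.min (c - f s) e.
  have m0 : 0 < m by rewrite lt_min subr_gt0 fsc.
  have d0 : 0 < T - s + 1 by rewrite ltr_wpDl // subr_ge0.
  exists (m / (T - s + 1)); split; first exact: divr_gt0.
    apply: (@lt_le_trans _ _ m); last by rewrite ge_min lexx.
    by rewrite mulrAC ltr_pdivrMr // ltr_pM2l // ltrDl.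
  apply: (@le_trans _ _ m); last by rewrite ge_min lexx orbT.
  by rewrite mulrAC ler_pdivrMr // ler_pM2l // lerDl.
pose S := [set t | s <= t <= T /\
  forall r, s <= r <= t -> f r <= f s + eps * (r - s)].
have Ss : S s.
  split; first by rewrite lexx sT.
  by move=> r /andP[sr rs]; rewrite (@le_anti _ _ r s) ?rs // subrr mulr0 addr0.
have Sub : ubound S T by move=> t [/andP[]].
pose t := sup S.
have st : s <= t by apply: ub_le_sup => //; exists T.
have tT : t <= T by apply: ge_sup => //; exists s.
have below r : s <= r < t -> f r <= f s + eps * (r - s).
  move=> /andP[sr rt].
  have [q [_ Sq] rq] := sup_gt (ex_intro _ s Ss) rt.
  by apply: Sq; rewrite sr ltW.
have St : S t.
  split; first by rewrite st tT.
  move=> r /andP[sr]; rewrite le_eqVlt => /predU1P[->|rt]; last first.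
    by apply: below; rewrite sr.
  move: st; rewrite le_eqVlt => /predU1P[<-|st].
    by rewrite subrr mulr0 addr0.
  have lim : f r - eps * (r - s) @[r --> t^'-] --> f t - eps * (t - s).
    apply: cvgB; first exact/cvg_at_left_filter/cf.
    apply: cvgMr; apply: cvgB; last exact: cvg_cst.
    exact/cvg_at_left_filter/cvg_id.
  rewrite -lerBlDr; apply: (cvgr_to_le lim).
  near=> q; rewrite lerBlDr; apply: below; apply/andP; split.
    by near: q; exact: nbhs_left_ge.
  by near: q; exact: nbhs_left_lt.
move: tT; rewrite le_eqVlt => /predU1P[tE|tT].
  case: St => _ /(_ T); rewrite tE lexx sT => /(_ isT); lra.
have ft : f t <= f s + eps * (t - s) by apply: St.2; rewrite st lexx.
have ftc : f t < c.
  apply: (le_lt_trans ft); suff : eps * (t - s) <= eps * (T - s) by lra.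
  by rewrite ler_pM2l // lerD2r ltW.
have [d /= d0 hd] := df t st ftc eps eps0.
pose q := Num.min (d / 2) (T - t).
have q0 : 0 < q by rewrite lt_min divr_gt0 //= subr_gt0.
suff : S (t + q) by move=> /(ub_le_sup (ex_intro _ T Sub)); rewrite -/t; lra.
have qT : q <= T - t by rewrite ge_min lexx orbT.
have qd : q <= d / 2 by rewrite ge_min lexx.
split; first by lra.
move=> r /andP[sr rq]; have [rt|tr] := ltP r t.
  by apply: below; rewrite sr.
move: tr; rewrite le_eqVlt => /predU1P[<- //|tr].
have : f (t + (r - t)) <= f t + eps * (r - t).
  by apply: hd; rewrite /ball_ /=; [rewrite sub0r normrN gtr0_norm|]; lra.
by rewrite addrC subrK; lra.
Unshelve. all: by end_near. Qed.

(** Gronwall's inequality for [f' <= l f] in the sense of Dini, obtained from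
    [nonincreasing_of_dini] applied to [e^(- l t) f t], since
    [e^(- l h) (1 + l h) <= 1] whatever the sign of [l]. A solution need not be
    differentiable at time [0], so monotonicity is first proved on [s, +oo[ and
    then passed to the limit [s -> 0]. *)
Lemma exp_bound_of_dini (R : realType) (f : R -> R) (c l : R) :
  {within `[0, +oo[, continuous f} -> (forall t, 0 <= f t) -> f 0 < c ->
  (forall t, 0 < t -> expR (- (l * t)) * f t < c -> forall eps, 0 < eps ->
     \forall h \near 0^'+, f (t + h) <= (1 + l * h) * f t + eps * h) ->
  forall t, 0 <= t -> f t <= expR (l * t) * f 0.
Proof.
move=> /continuous_within_itvcyP[cf cf0] f0 f0c df.
pose N t := expR (- (l * t)) * f t.
have cE : continuous (fun t : R => expR (- (l * t))).
  move=> t; apply: continuous_comp; last exact: continuous_expR.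
  by apply: continuousN; apply: continuousM; [exact: cvg_cst|exact: cvg_id].
have cN t : 0 < t -> {for t, continuous N}.
  by move=> t0; apply: continuousM; [exact: cE|apply: cf; rewrite in_itv /= t0].
have cN0 : N s @[s --> 0^'+] --> N 0.
  by apply: cvgM => //; apply: cvg_at_right_filter; exact: cE.
have dN t : 0 < t -> N t < c -> forall eps, 0 < eps ->
    \forall h \near 0^'+, N (t + h) <= N t + eps * h.
  move=> t0 Nc eps eps0.
  (* [e^(- l (t + h)) <= e^(- l t) e^|l|] for [0 < h <= 1]; [eps'] absorbs it. *)
  pose eps' := eps * expR (l * t) * expR (- `|l|).
  have eps'0 : 0 < eps' by rewrite !mulr_gt0 ?expR_gt0.
  near=> h.
  have h0 : 0 < h by near: h; exact: nbhs_right_gt.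
  have h1 : h <= 1 by near: h; apply: nbhs_right_le.
  have fh : f (t + h) <= (1 + l * h) * f t + eps' * h.
    by near: h; exact: df.
  have E : N (t + h) = expR (- (l * t)) * (expR (- (l * h)) * f (t + h)).
    by rewrite /N mulrDr opprD expRD mulrA.
  have e1 : expR (- (l * h)) * (1 + l * h) <= 1.
    rewrite [leRHS](_ : 1 = expR (- (l * h)) * expR (l * h)).
      by rewrite ler_pM2l ?expR_gt0 // expR_ge1Dx.
    by rewrite -expRD addNr expR0.
  have e2 : expR (- (l * h)) <= expR `|l|.
    rewrite ler_expR -mulNr (le_trans (ler_norm _)) // normrM normrN.
    by rewrite (gtr0_norm h0) ler_piMr.
  have e3 : expR (- (l * t)) * (expR `|l| * (eps' * h)) = eps * h.
    rewrite /eps' !expRN; field.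
    by rewrite !gt_eqF ?expR_gt0.
  rewrite E -e3 /N -mulrDr ler_pM2l ?expR_gt0 //.
  apply: (@le_trans _ _ (expR (- (l * h)) * ((1 + l * h) * f t + eps' * h))).
    by rewrite ler_pM2l ?expR_gt0.
  rewrite mulrDr mulrA lerD //; first by rewrite ler_piMl.
  by rewrite ler_pM2r // mulr_gt0.
have N0 : N 0 = f 0 by rewrite /N mulr0 oppr0 expR0 mul1r.
move=> t; rewrite le_eqVlt => /predU1P[<-|t0].
  by rewrite mulr0 expR0 mul1r.
have -> : f t = expR (l * t) * N t.
  by rewrite /N mulrA -expRD subrr expR0 mul1r.
rewrite ler_pM2l ?expR_gt0 // -N0.
apply: (cvgr_to_ge cN0); near=> s.
have s0 : 0 < s by near: s; exact: nbhs_right_gt.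
apply: (@nonincreasing_of_dini R N c).
- by move=> r sr; apply: cN; exact: lt_trans sr.
- by move=> r sr; apply: dN; exact: lt_le_trans sr.
- by near: s; apply: (cvgr_lt _ cN0); rewrite N0.
- by near: s; exact: nbhs_right_le.
Unshelve. all: by end_near. Qed.

(** * Lipschitz maps and expansions to first order in normed spaces *)

(** The constant may depend on the point, which is what a quadratic map such as
    [Gamma] requires. *)
Lemma locally_lipschitz_continuous (R : realType) (V W : normedModType R)
    (f : V -> W) (C : V -> R) :
  (forall x y, `|x - y| <= 1 -> `|f x - f y| <= C x * `|x - y|) ->
  continuous f.
Proof.
move=> fC x; apply/cvgrPdist_le => e e0.
have C1 : 0 < `|C x| + 1 by rewrite ltr_wpDl.
have le_near (d : R) : 0 < d -> \forall y \near x, `|x - y| <= d.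
  by move=> d0; apply: (@cvgr_dist_le _ _ _ _ _ id x).
near=> y.
have y1 : `|x - y| <= 1 by near: y; exact: le_near.
have ye : `|x - y| <= e / (`|C x| + 1).
  by near: y; apply: le_near; exact: divr_gt0.
rewrite (le_trans (fC x y y1)) //.
apply: (@le_trans _ _ ((`|C x| + 1) * `|x - y|)).
  by rewrite ler_wpM2r // (le_trans (ler_norm _)) // lerDl.
by rewrite mulrC -ler_pdivlMr.
Unshelve. all: by end_near. Qed.

Lemma derivable_right_expansion (R : realType) (V : normedModType R)
    (u : R -> V) (t : R) :
  derivable u t 1 -> forall e, 0 < e ->
  \forall h \near 0^'+, `|u (t + h) - u t - h *: derive1 u t| <= e * h.
Proof.
move=> du e e0.
have lim : h^-1 *: (u (h + t) - u t) @[h --> 0^'] --> derive1 u t.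
  have := du; rewrite /derivable derive1E /derive.
  have -> : (fun h : R => h^-1 *: ((u \o shift t) (h *: 1) - u t)) =
            (fun h => h^-1 *: (u (h + t) - u t)).
    by apply/funext => h /=; rewrite /GRing.scale /= mulr1.
  by [].
near=> h.
have h0 : 0 < h by near: h; exact: nbhs_right_gt.
have -> : u (t + h) - u t - h *: derive1 u t =
    h *: (h^-1 *: (u (h + t) - u t) - derive1 u t).
  by rewrite scalerBr scalerA divff ?gt_eqF // scale1r [t + h]addrC.
rewrite normrZ gtr0_norm // mulrC ler_pM2r //.
near: h; exact: (cvgr_distC_le _ _ (cvg_dnbhs_at_right lim)).
Unshelve. all: by end_near. Qed.

Lemma derivable_of_quadratic_remainder (R : realType) (V : normedModType R)
    (u : R -> V) (D : V) (t d C : R) : 0 < d ->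
  (forall h, `|h| < d -> `|u (t + h) - u t - h *: D| <= C * h ^+ 2) ->
  derivable u t 1 /\ derive1 u t = D.
Proof.
move=> d0 uD.
have lim : h^-1 *: (u (h + t) - u t) @[h --> 0^'] --> D.
  apply/cvgrPdistC_le => e e0; near=> h.
  have h0 : h != 0 by near: h; exact: nbhs_dnbhs_neq.
  have h0' : 0 < `|h| by rewrite normr_gt0.
  have hd : `|h| < d by near: h; apply: dnbhs0_lt.
  have he : `|h| <= e / (`|C| + 1).
    by near: h; apply: dnbhs0_le; rewrite divr_gt0 // ltr_wpDl.
  have -> : h^-1 *: (u (h + t) - u t) - D = h^-1 *: (u (t + h) - u t - h *: D).
    by rewrite [in RHS]scalerBr scalerA mulVf // scale1r [t + h]addrC.
  rewrite normrZ normfV ler_pdivrMl //.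
  rewrite (le_trans (uD h hd)) // -(real_normK (num_real h)) expr2 mulrCA.
  rewrite ler_pM2l //.
  apply: (@le_trans _ _ ((`|C| + 1) * `|h|)).
    by rewrite ler_wpM2r // (le_trans (ler_norm C)) // lerDl.
  by rewrite mulrC -ler_pdivlMr // ltr_wpDl.
split; last by apply: cvg_lim => //; exact: norm_hausdorff.
rewrite /derivable.
have -> : (fun h : R => h^-1 *: ((u \o shift t) (h *: 1) - u t)) =
          (fun h => h^-1 *: (u (h + t) - u t)).
  by apply/funext => h /=; rewrite /GRing.scale /= mulr1.
exact: cvgP lim.
Unshelve. all: by end_near. Qed.

(** * The space of bounded functions *)

Section sup_norm.
Context {R : realType} {T : Type}.
Implicit Types f g : linfty T R.

Lemma linfty_norm_ge f x : `|f x| <= `|f|.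
Proof. exact: supnorm_ge. Qed.

Lemma linfty_norm_le f M : 0 <= M -> (forall x, `|f x| <= M) -> `|f| <= M.
Proof. exact: supnorm_le. Qed.

Lemma linfty_eq f g : (forall x, f x = g x) -> f = g.
Proof. by move=> fg; apply/val_inj/funext. Qed.

End sup_norm.

(** * Neighbourhood averages and the maximum principle for Gamma *)

Section mean.
Context {R : realType} {G : weightedGraph R}.
Implicit Types (a b f g : G -> R) (x y : G).

Definition mean a x : R := \sum_(y \in nbr x) Defs.kernel x y * a y.

Lemma meanE a x :
  mean a x = \sum_(y <- fset_set (nbr x)) Defs.kernel x y * a y.
Proof. by rewrite /mean fsbig_finite //; exact: nbr_finite. Qed.

Lemma mean_lin a b c x :
  mean (fun y => a y + c * b y) x = mean a x + c * mean b x.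
Proof.
rewrite !meanE mulr_sumr -big_split; apply: eq_bigr => y _ /=; ring.
Qed.

Lemma mean_cst c x : mean (fun=> c) x = c.
Proof.
rewrite -[RHS]mul1r -(kernel_markov x) fsbig_finite; last exact: nbr_finite.
by rewrite meanE mulr_suml.
Qed.

Lemma eq_mean a b x : (forall y, adj x y -> a y = b y) -> mean a x = mean b x.
Proof.
move=> ab; rewrite !meanE !big_seq; apply: eq_bigr => y.
by rewrite in_fset_set; [move=> /set_mem/ab ->|exact: nbr_finite].
Qed.

Lemma le_mean a b x : (forall y, adj x y -> a y <= b y) -> mean a x <= mean b x.
Proof.
move=> ab; rewrite !meanE !big_seq; apply: ler_sum => y.
rewrite in_fset_set; last exact: nbr_finite.
by move=> /set_mem/ab ?; rewrite ler_wpM2l ?kernel_ge0.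
Qed.

Lemma norm_mean_le a x C : (forall y, `|a y| <= C) -> `|mean a x| <= C.
Proof.
move=> aC; rewrite ler_norml -{1}(mean_cst (- C) x) -{2}(mean_cst C x).
by apply/andP; split; apply: le_mean => y _;
  have := aC y; rewrite ler_norml => /andP[].
Qed.

Lemma kernel_le_mean a x y :
  (forall z, 0 <= a z) -> adj x y -> Defs.kernel x y * a y <= mean a x.
Proof.
move=> a0 xy; rewrite meanE (bigD1_seq y) //=; last exact: fset_uniq.
  by rewrite lerDl sumr_ge0 // => z _; rewrite mulr_ge0 ?kernel_ge0.
by rewrite in_fset_set ?mem_set //; exact: nbr_finite.
Qed.

Lemma DeltaE f x : Delta f x = mean f x - f x.
Proof.
have -> : Delta f x = mean (fun y => f y + (-1) * f x) x.
  by rewrite /Delta -/(mean _ _); apply: eq_mean => y _; rewrite mulN1r.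
by rewrite mean_lin mean_cst mulN1r.
Qed.

Lemma Gamma_mean f g x :
  Gamma f g x = 2^-1 * mean (fun y => (f y - f x) * (g y - g x)) x.
Proof.
rewrite /Gamma !DeltaE; congr (_ * _).
rewrite [in RHS](@eq_mean _ (fun y => (f y * g y + (- g x) * f y) +
  (- f x) * (g y + (-1) * g x))); last by move=> y _; ring.
by rewrite !mean_lin mean_cst /=; ring.
Qed.

Lemma Gamma_ge0 f x : 0 <= Gamma f f x.
Proof.
rewrite Gamma_mean mulr_ge0 ?invr_ge0 // -(mean_cst 0 x).
by apply: le_mean => y _; rewrite -expr2 sqr_ge0.
Qed.

Lemma GammaC f g x : Gamma f g x = Gamma g f x.
Proof. by rewrite !Gamma_mean; congr (_ * _); apply: eq_mean => y _; ring. Qed.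

Lemma Gamma_linr f g k c x :
  Gamma f (fun y => g y + c * k y) x = Gamma f g x + c * Gamma f k x.
Proof.
rewrite !Gamma_mean mulrCA -mulrDr -mean_lin; congr (_ * _).
by apply: eq_mean => y _; ring.
Qed.

Lemma Gamma_expand f w h x :
  Gamma (fun y => f y + h * w y) (fun y => f y + h * w y) x =
  Gamma f f x + 2 * h * Gamma f w x + h ^+ 2 * Gamma w w x.
Proof.
rewrite Gamma_linr GammaC [X in _ + h * X]GammaC !Gamma_linr.
by rewrite [Gamma w f x]GammaC; ring.
Qed.

Lemma norm_Gamma_le f g A B x :
  (forall y, `|f y| <= A) -> (forall y, `|g y| <= B) ->
  `|Gamma f g x| <= 2 * A * B.
Proof.
move=> fA gB; rewrite Gamma_mean normrM ger0_norm ?invr_ge0 //.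
rewrite -ler_pdivlMl ?invr_gt0 // invrK; apply: norm_mean_le => y.
rewrite normrM (@le_trans _ _ ((A + A) * (B + B))) //; last by lra.
by rewrite ler_pM // (le_trans (ler_normB _ _)) // lerD.
Qed.

(** One explicit Euler step of length [h] for the equation satisfied by
    [g = Gamma f f]. After CD(K, oo), the neighbours of [x] enter only through
    the average of [(1 + f y - f x) (g y - g x)]. The weights are nonnegative,
    so replacing [g y] by its bound [M] can only increase it, and the total
    weight is at most [2]; for small [h] the coefficient of [g x] remains
    nonnegative, and [g x] may be replaced by [M] as well. *)
Lemma Gamma_max_principle f K M h x :
  CD_infty G K -> 0 <= h -> h * (2 + 2 * K) <= 1 ->
  (forall y z, adj y z -> `|f z - f y| <= 1) ->
  (forall y, Gamma f f y <= M) ->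
  Gamma f f x + 2 * h * Gamma f (Delta f \+ Gamma f f) x <= (1 - 2 * K * h) * M.
Proof.
move=> CD h0 hK f1 gM; set g := Gamma f f.
have -> : Gamma f (Delta f \+ g) x = Gamma f (Delta f) x + Gamma f g x.
  have -> : Delta f \+ g = (fun y => Delta f y + 1 * g y).
    by apply/funext => y /=; rewrite mul1r.
  by rewrite Gamma_linr mul1r.
have E : Delta g x + 2 * Gamma f g x =
    mean (fun y => (1 + (f y - f x)) * (g y - g x)) x.
  rewrite Gamma_mean mulrA divff // DeltaE.
  rewrite (@eq_mean (fun y => (1 + _) * _) (fun y =>
     (g y + (-1) * g x) + 1 * ((f y - f x) * (g y - g x)))).
    by rewrite !mean_lin mean_cst /=; ring.
  by move=> y _; ring.
have le2 : Delta g x + 2 * Gamma f g x <= 2 * (M - g x).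
  rewrite E -(mean_cst (2 * (M - g x)) x); apply: le_mean => y xy.
  have := f1 x y xy; rewrite ler_norml => /andP[? ?].
  by have := gM y; have := gM x; rewrite -/g; nra.
have := CD f x; rewrite /Gamma2 -/g => CDx.
have := gM x; rewrite -/g => gMx.
have : h * (Delta g x + 2 * Gamma f g x) <= h * (2 * (M - g x)).
  by rewrite ler_wpM2l.
have : h * (K * g x) <= h * (2^-1 * Delta g x - Gamma f (Delta f) x).
  by rewrite ler_wpM2l.
have : 0 <= (1 - h * (2 + 2 * K)) * (M - g x) by rewrite mulr_ge0 // subr_ge0.
lra.
Qed.

End mean.

(** * The clipped vector field *)

Section truncation.
Context {R : realType} {G : weightedGraph R}.
Implicit Types (f g : G -> R) (x y : G) (s r : R).

Definition clip s : R := Num.max (-1) (Num.min 1 s).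

(** The response [d + d^2 / 2] of [Delta + Gamma] to an increment [d], extended
    by constants outside [-1, 1]. *)
Definition clipped_reaction s : R := clip s + 2^-1 * clip s ^+ 2.

Lemma clip_itv s : -1 <= clip s <= 1.
Proof.
by rewrite /clip; case: (leP (-1) (Num.min 1 s)); case: (leP 1 s) => ? ?;
  apply/andP; split; lra.
Qed.

Lemma clip_id s : `|s| <= 1 -> clip s = s.
Proof.
rewrite ler_norml => /andP[h1 h2]; rewrite /clip.
by case: (leP (-1) (Num.min 1 s)); case: (leP 1 s) => ? ?; lra.
Qed.

Lemma clip_contract s r : `|clip s - clip r| <= `|s - r|.
Proof.
wlog sr : s r / s <= r.
  move=> H; have [/H//|/ltW/H] := leP s r.
  by rewrite distrC [leRHS]distrC.
rewrite ler_norml (distrC s r) (@ger0_norm _ (r - s)) ?subr_ge0 // /clip.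
by case: (leP (-1) (Num.min 1 s)); case: (leP 1 s) => ? ?;
  case: (leP (-1) (Num.min 1 r)); case: (leP 1 r) => ? ?; apply/andP; split; lra.
Qed.

Lemma norm_clipped_reaction_le s : `|clipped_reaction s| <= 2.
Proof.
have /andP[? ?] := clip_itv s.
by rewrite ler_norml /clipped_reaction; apply/andP; split; nra.
Qed.

Lemma clipped_reaction_lip s r :
  `|clipped_reaction s - clipped_reaction r| <= 2 * `|s - r|.
Proof.
have -> : clipped_reaction s - clipped_reaction r =
    (1 + 2^-1 * (clip s + clip r)) * (clip s - clip r).
  by rewrite /clipped_reaction; ring.
rewrite normrM ler_pM // ?clip_contract //.
have := clip_itv s; have := clip_itv r => /andP[? ?] /andP[? ?].
by rewrite ler_norml; apply/andP; split; lra.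
Qed.

Definition clipped_generator f : G -> R :=
  fun x => mean (fun y => clipped_reaction (f y - f x)) x.

Lemma norm_clipped_generator_le f x : `|clipped_generator f x| <= 2.
Proof. by apply: norm_mean_le => y; exact: norm_clipped_reaction_le. Qed.

Lemma clipped_generator_lip f g D x : (forall y, `|f y - g y| <= D) ->
  `|clipped_generator f x - clipped_generator g x| <= 4 * D.
Proof.
move=> fg; rewrite /clipped_generator -[- mean _ _]mulN1r -mean_lin.
apply: norm_mean_le => y; rewrite mulN1r.
rewrite (le_trans (clipped_reaction_lip _ _)) //.
have -> : f y - f x - (g y - g x) = (f y - g y) - (f x - g x) by ring.
have := ler_normB (f y - g y) (f x - g x); have := fg x; have := fg y; lra.
Qed.

(** [Delta f + Gamma f] averages [d + d^2 / 2] over the increments [d] of [f],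
    so clipping increments that lie in [-1, 1] changes nothing. *)
Lemma clipped_generatorE f x : (forall y, adj x y -> `|f y - f x| <= 1) ->
  clipped_generator f x = Delta f x + Gamma f f x.
Proof.
move=> f1; rewrite Gamma_mean DeltaE.
rewrite (_ : mean f x - f x = mean (fun y => f y + (-1) * f x) x); last first.
  by rewrite mean_lin mean_cst mulN1r.
rewrite -mean_lin; apply: eq_mean => y /f1 fy.
by rewrite /clipped_reaction clip_id //; ring.
Qed.

(** The single edge [x y] contributes [kernel x y / 2 * (f y - f x)^2] to
    [Gamma f f x], and [kernel x y >= alpha]. *)
Lemma increment_le1 f alpha x y : bounded_geometry G alpha ->
  Gamma f f x < alpha / 2 -> adj x y -> `|f y - f x| <= 1.
Proof.
move=> [a0 ell _] gx xy.
have a2 : 0 < alpha / 2 by rewrite divr_gt0.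
have h : alpha * (f y - f x) ^+ 2 <= 2 * Gamma f f x.
  rewrite Gamma_mean mulVKf //.
  apply: le_trans (kernel_le_mean (fun y => (f y - f x) * (f y - f x)) _ _ _ xy).
    by rewrite -expr2 ler_wpM2r ?sqr_ge0 // ell.
  by move=> z; rewrite -expr2 sqr_ge0.
rewrite -(@ler_pXn2r _ 2) ?nnegrE // expr1n real_normK ?num_real //.
by rewrite -(ler_pM2l a0) mulr1; lra.
Qed.

Lemma clipped_generator_bounded f : clipped_generator f \in boundedf.
Proof. by apply/boundedfP; exists 2 => x; exact: norm_clipped_generator_le. Qed.

Definition linfty_clipped f : linfty G R := Linfty (clipped_generator_bounded f).

End truncation.

(** * Gradient decay and uniqueness along the flow *)

Section flow.
Context {R : realType} {G : weightedGraph R}.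
Implicit Types (f g : linfty G R).

Lemma linfty_Gamma_continuous : continuous (@linfty_Gamma R G).
Proof.
apply: (@locally_lipschitz_continuous _ _ _ _ (fun f => 4 * `|f| + 2)) => f g fg1.
have gE : (g : G -> R) = (fun y => f y + (-1) * (f - g) y).
  by apply/funext => y /=; rewrite mulN1r opprB addrC subrK.
apply: linfty_norm_le => [|x]; first by rewrite mulr_ge0 // addr_ge0 ?mulr_ge0.
change (`|Gamma f f x - Gamma g g x| <= (4 * `|f| + 2) * `|f - g|).
rewrite gE Gamma_expand.
have n1 := norm_Gamma_le f (f - g) `|f| `|f - g| x
  (linfty_norm_ge _) (linfty_norm_ge _).
have n2 := norm_Gamma_le (f - g) (f - g) `|f - g| `|f - g| x
  (linfty_norm_ge _) (linfty_norm_ge _).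
set a := Gamma f f x; set b := Gamma f (f - g) x in n1 *.
set c := Gamma (f - g) (f - g) x in n2 *.
have -> : a - (a + 2 * -1 * b + (- 1) ^+ 2 * c) = 2 * b - c by ring.
have := ler_normB (2 * b) c; rewrite normrM (ger0_norm (ler0n _ 2)).
have := normr_ge0 (f - g); nra.
Qed.

Lemma linfty_clipped_lip f g :
  `|linfty_clipped f - linfty_clipped g| <= 4 * `|f - g|.
Proof.
apply: linfty_norm_le => [|x]; first by rewrite mulr_ge0.
apply: clipped_generator_lip => y; exact: (linfty_norm_ge (f - g)).
Qed.

Lemma linfty_clipped_continuous :
  continuous (fun f : linfty G R => linfty_clipped f).
Proof.
apply: (@locally_lipschitz_continuous _ _ _ _ (fun=> 4)) => f g _.
exact: linfty_clipped_lip.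
Qed.

Lemma linfty_clippedE alpha f : bounded_geometry G alpha ->
  `|linfty_Gamma f| < alpha / 2 ->
  linfty_clipped f = linfty_Delta f + linfty_Gamma f.
Proof.
move=> geomG fa; apply: linfty_eq => x; apply: clipped_generatorE => y.
apply: increment_le1 geomG _; apply: le_lt_trans fa.
exact: le_trans (ler_norm _) (linfty_norm_ge (linfty_Gamma f) x).
Qed.

(** Write [u (t + h) = u t + h w], where the difference quotient [w] is close to
    [D = Delta u + Gamma u]. Since [Gamma] is quadratic,
    [Gamma (u + h w) = Gamma u + 2 h Gamma(u, D) + 2 h Gamma(u, w - D) +
    h^2 Gamma w]; the first two terms are the Euler step of
    [Gamma_max_principle], the last two are [o(h)] uniformly on the graph. *)
Lemma Gamma_flow_dini (alpha K : R) (u : R -> linfty G R) (t : R) :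
  bounded_geometry G alpha -> 0 <= K -> CD_infty G K ->
  `|linfty_Gamma (u t)| < alpha / 2 ->
  derivable u t 1 -> derive1 u t = linfty_Delta (u t) + linfty_Gamma (u t) ->
  forall e, 0 < e -> \forall h \near 0^'+,
    `|linfty_Gamma (u (t + h))| <=
      (1 + (- 2 * K) * h) * `|linfty_Gamma (u t)| + e * h.
Proof.
move=> geomG K0 CD ua du u't e e0.
set M := `|linfty_Gamma (u t)|; set D := derive1 u t in u't *.
pose B := `|D| + 1.
have A0 : 0 <= `|u t| by [].
have B0 : 0 < B by rewrite ltr_wpDl.
(* Allowed distance from [w] to [D]: the error [4 h |u t| d] it causes is at most
   half of [e h]. *)
pose d := Num.min 1 (e / (8 * (`|u t| + 1))).
have d0 : 0 < d by rewrite lt_min ltr01 divr_gt0 // mulr_gt0 // ltr_wpDl.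
have d1 : d <= 1 by rewrite ge_min lexx.
have de : 4 * `|u t| * d <= e / 2.
  have : d <= e / (8 * (`|u t| + 1)) by rewrite ge_min lexx orbT.
  rewrite ler_pdivlMr; last by rewrite mulr_gt0 // ltr_wpDl.
  by move: d0; nra.
near=> h.
have h0 : 0 < h by near: h; exact: nbhs_right_gt.
have hK : h * (2 + 2 * K) <= 1.
  rewrite -ler_pdivlMr; last by rewrite ltr_wpDr // mulr_ge0.
  by near: h; apply: nbhs_right_le; rewrite divr_gt0 // ltr_wpDr // mulr_ge0.
have he : 2 * B ^+ 2 * h <= e / 2.
  rewrite mulrC -ler_pdivlMr; last by rewrite mulr_gt0 // exprn_gt0.
  by near: h; apply: nbhs_right_le; rewrite !divr_gt0 // mulr_gt0 // exprn_gt0.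
pose w : linfty G R := h^-1 *: (u (t + h) - u t).
have wD : `|w - D| <= d.
  have -> : w - D = h^-1 *: (u (t + h) - u t - h *: D).
    by rewrite [in RHS]scalerBr scalerA mulVf ?gt_eqF // scale1r.
  rewrite normrZ gtr0_norm ?invr_gt0 // ler_pdivrMl // mulrC.
  by near: h; exact: derivable_right_expansion.
have wB : `|w| <= B.
  rewrite -(subrK D w) (le_trans (ler_normD _ _)) // addrC lerD2l.
  exact: le_trans d1.
have uE : (u (t + h) : G -> R) = (fun y => u t y + h * w y).
  apply/funext => y.
  change (u (t + h) y = u t y + h * (h^-1 * (u (t + h) y - u t y))).
  by rewrite mulVKf ?gt_eqF //; ring.
have gM y : Gamma (u t) (u t) y <= M.
  exact: le_trans (ler_norm _) (linfty_norm_ge (linfty_Gamma (u t)) y).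
have M0 : 0 <= M by rewrite normr_ge0.
have rhs0 : 0 <= (1 + - 2 * K * h) * M + e * h.
  rewrite addr_ge0 ?mulr_ge0 ?(ltW e0) ?(ltW h0) //; nra.
apply: linfty_norm_le => // x.
change (`|Gamma (u (t + h)) (u (t + h)) x| <= (1 + - 2 * K * h) * M + e * h).
rewrite ger0_norm ?Gamma_ge0 // uE Gamma_expand.
have wE : (w : G -> R) =
    (fun y => (Delta (u t) \+ Gamma (u t) (u t)) y + 1 * (w - D) y).
  apply/funext => y; rewrite mul1r u't.
  change (w y = (Delta (u t) y + Gamma (u t) (u t) y) +
    (w y - (Delta (u t) y + Gamma (u t) (u t) y))).
  by move: (w y) (Delta _ _ + _) => a b; ring.
have E : Gamma (u t) w x = Gamma (u t) (Delta (u t) \+ Gamma (u t) (u t)) x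
    + Gamma (u t) (w - D) x.
  by rewrite {1}wE Gamma_linr mul1r.
have n1 : Gamma (u t) (w - D) x <= 2 * `|u t| * d.
  apply: le_trans (ler_norm _) _.
  apply: norm_Gamma_le => y; first exact: linfty_norm_ge.
  exact: le_trans (linfty_norm_ge _ y) wD.
have n2 : Gamma w w x <= 2 * B * B.
  apply: le_trans (ler_norm _) _.
  by apply: norm_Gamma_le => y; exact: le_trans (linfty_norm_ge _ y) wB.
have edge y z : adj y z -> `|u t z - u t y| <= 1.
  by apply: increment_le1 geomG _; exact: le_lt_trans (gM y) ua.
have := Gamma_max_principle (u t) K M h x CD (ltW h0) hK edge gM.
have m1 : h * Gamma (u t) (w - D) x <= h * (2 * `|u t| * d) by rewrite ler_pM2l.
have m2 : h ^+ 2 * Gamma w w x <= h ^+ 2 * (2 * B * B).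
  by rewrite ler_pM2l // exprn_gt0.
have m3 : h * (4 * `|u t| * d) <= h * (e / 2) by rewrite ler_pM2l.
have m4 : h * (2 * B ^+ 2 * h) <= h * (e / 2) by rewrite ler_pM2l.
rewrite E; lra.
Unshelve. all: by end_near. Qed.

(** The equation is only required while [Gamma u] is below the threshold, so
    that the lemma applies to the solutions of the original equation and to the
    clipped flow alike. *)
Lemma Gamma_flow_decay (alpha K : R) (u : R -> linfty G R) :
  bounded_geometry G alpha -> 0 <= K -> CD_infty G K ->
  {within `[0, +oo[, continuous u} ->
  `|linfty_Gamma (u 0)| < alpha / 2 ->
  (forall t, 0 < t -> `|linfty_Gamma (u t)| < alpha / 2 ->
     derivable u t 1 /\
     derive1 u t = linfty_Delta (u t) + linfty_Gamma (u t)) ->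
  forall t, 0 <= t ->
    `|linfty_Gamma (u t)| <= expR (- 2 * K * t) * `|linfty_Gamma (u 0)|.
Proof.
move=> geomG K0 CD cu u0a du.
apply: (@exp_bound_of_dini R (fun t => `|linfty_Gamma (u t)|) (alpha / 2)) => //.
  move=> t; apply: continuous_comp; last exact: norm_continuous.
  by apply: continuous_comp; [exact: cu|exact: linfty_Gamma_continuous].
move=> t t0 ta; have ua : `|linfty_Gamma (u t)| < alpha / 2.
  apply: le_lt_trans ta; rewrite ler_peMl // -[leLHS]expR0 ler_expR.
  by rewrite !mulNr opprK; apply: mulr_ge0; [exact: mulr_ge0|exact: ltW].
by have [d1 d2] := du t t0 ua; exact: Gamma_flow_dini geomG K0 CD ua d1 d2.
Qed.

(** The clipped field is [4]-Lipschitz, so [|u - v|' <= 4 |u - v|] in the sense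
    of Dini; the threshold of [exp_bound_of_dini] can be any positive number. *)
Lemma clipped_flow_unique (u v : R -> linfty G R) :
  {within `[0, +oo[, continuous u} -> {within `[0, +oo[, continuous v} ->
  (forall t, 0 < t -> derivable u t 1 /\ derive1 u t = linfty_clipped (u t)) ->
  (forall t, 0 < t -> derivable v t 1 /\ derive1 v t = linfty_clipped (v t)) ->
  u 0 = v 0 -> forall t, 0 <= t -> u t = v t.
Proof.
move=> cu cv du dv uv0 t t0; apply/eqP; rewrite -subr_eq0 -normr_le0.
apply: le_trans (@exp_bound_of_dini R (fun t => `|u t - v t|) 1 4 _ _ _ _ t t0) _.
- move=> s; apply: continuous_comp; last exact: norm_continuous.
  by apply: continuousB; [exact: cu|exact: cv].
- by [].
- by rewrite uv0 subrr normr0.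
- move=> s s0 _ e e0.
  have [d1 d2] := du s s0; have [d3 d4] := dv s s0.
  have e2 : 0 < e / 2 by rewrite divr_gt0.
  have := derivable_right_expansion _ _ _ _ d1 _ e2; rewrite d2 => nu.
  have := derivable_right_expansion _ _ _ _ d3 _ e2; rewrite d4 => nv.
  near=> h.
  have h0 : 0 < h by near: h; exact: nbhs_right_gt.
  have n1 : `|u (s + h) - u s - h *: linfty_clipped (u s)| <= e / 2 * h.
    by near: h; exact: nu.
  have n2 : `|v (s + h) - v s - h *: linfty_clipped (v s)| <= e / 2 * h.
    by near: h; exact: nv.
  set a := u _ - _ - _ in n1; set b := v _ - _ - _ in n2.
  have -> : u (s + h) - v (s + h) =
      (u s - v s) + h *: (linfty_clipped (u s) - linfty_clipped (v s)) + (a - b).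
    apply: linfty_eq => x; rewrite /a /b.
    change (u (s + h) x - v (s + h) x = u s x - v s x +
      h * (linfty_clipped (u s) x - linfty_clipped (v s) x) +
      ((u (s + h) x - u s x - h * linfty_clipped (u s) x) -
       (v (s + h) x - v s x - h * linfty_clipped (v s) x))); ring.
  have := ler_normB a b.
  set F := linfty_clipped (u s) - linfty_clipped (v s).
  have := ler_normD (u s - v s + h *: F) (a - b).
  have := ler_normD (u s - v s) (h *: F).
  rewrite normrZ gtr0_norm //.
  have : h * `|F| <= h * (4 * `|u s - v s|).
    by rewrite ler_pM2l // linfty_clipped_lip.
  lra.
- by rewrite uv0 subrr normr0 mulr0.
Unshelve. all: by end_near. Qed.

End flow.

(** * Existence of the clipped flow *)

Section picard.
Context {R : realType} {G : weightedGraph R}.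
Implicit Types (U V : R -> G -> R) (f : G -> R).

Definition time_lipschitz U := forall (x : G) (s t : R),
  0 <= s -> 0 <= t ->
  `|U s x - U t x| <= 2 * `|s - t|.

(** The graph of the Picard map. Derivatives are taken vertex by vertex, so that
    integration in time only involves real functions. *)
Definition picard_image f U V := V 0 = f /\
  forall (t : R) (x : G), 0 <= t ->
    is_derive t 1 (fun r => V r x) (clipped_generator (U t) x).

(** The clipped field is bounded by [2], hence so is the speed of [V]. *)
Lemma picard_image_lipschitz f U V : picard_image f U V -> time_lipschitz V.
Proof.
move=> [_ dV] x s t.
wlog ts : s t / t <= s.
  move=> H s0 t0; have [st|/ltW st] := leP t s; first exact: H.
  by rewrite distrC (distrC s t); exact: H.
move=> s0 t0; rewrite (@ger0_norm _ (s - t)) ?subr_ge0 // mulrBr.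
apply: (@mean_value_le R (fun r => V r x) (fun r => 2 * r)
  (fun r => clipped_generator (U r) x) (fun=> 2)) => // r /andP[tr rs].
- by apply: dV; exact: le_trans tr.
- by rewrite -[X in is_derive _ _ _ X]mulr1; exact: is_deriveZ.
- exact: norm_clipped_generator_le.
Qed.

Lemma picard_image_exists f U :
  time_lipschitz U -> exists V, picard_image f U V.
Proof.
move=> lU.
(* Extending the integrand by its value at time 0 to negative times makes it
   continuous on the whole line. *)
have H (x : G) : exists F : R -> R, F 0 = 0 /\ forall t : R, -1 < t ->
    is_derive t 1 F (clipped_generator (U (Num.max 0 t)) x).
  apply: primitive_after; last by lra.
  apply: (@locally_lipschitz_continuous _ _ _ _ (fun=> 8)) => s t _.
  have ge0 (r : R) : 0 <= Num.max 0 r by rewrite le_max lexx.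
  have max_lip := max0_contract _ s t.
  apply: le_trans (clipped_generator_lip _ _ (2 * `|s - t|) x _) _; last by lra.
  by move=> y; rewrite (le_trans (lU _ _ _ (ge0 s) (ge0 t))) // ler_pM2l.
have [P HP] := choice H.
exists (fun t x => f x + P x t); split.
  by apply/funext => x; rewrite (HP x).1 addr0.
move=> t x t0; rewrite -[X in is_derive _ _ _ X]add0r.
apply: is_deriveD; have := (HP x).2 t; rewrite max_r //; apply; lra.
Qed.

(** Distances are measured with the weight [e^(- 8 t)]. The field is
    [4]-Lipschitz and the primitive of [4 e^(8 t)] is at most [e^(8 t) / 2], so
    the Picard map is a contraction of ratio [1/2] on the whole half-line. *)
Lemma picard_contraction f U U' V V' A : picard_image f U V ->
  picard_image f U' V' ->
  (forall t x, 0 <= t -> `|U t x - U' t x| <= A * expR (8 * t)) ->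
  forall t x, 0 <= t -> `|V t x - V' t x| <= A / 2 * expR (8 * t).
Proof.
move=> [V0 dV] [V'0 dV'] UU' t x t0.
have A0 : 0 <= A.
  have := UU' 0 x (lexx 0); rewrite mulr0 expR0 mulr1; exact: le_trans.
have := @mean_value_le R (fun s => V s x - V' s x)
  (fun s => A / 2 * expR (8 * s))
  (fun s => clipped_generator (U s) x - clipped_generator (U' s) x)
  (fun s => 4 * (A * expR (8 * s))) 0 t t0.
rewrite V0 V'0 subrr subr0 mulr0 expR0 mulr1 => H.
apply: le_trans (H _ _ _) _; last by lra.
- by move=> s /andP[s0 _]; apply: is_deriveB; [exact: dV|exact: dV'].
- move=> s _.
  have -> : 4 * (A * expR (8 * s)) = A / 2 * (8 * expR (8 * s)) by field.
  apply: is_deriveZ.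
  have d8 : is_derive s 1 (fun r : R => 8 * r) 8.
    by rewrite -[X in is_derive _ _ _ X]mulr1; exact: is_deriveZ.
  by rewrite mulrC; exact: (@is_derive1_comp R expR (fun r => 8 * r) s _ _ _ d8).
- by move=> s /andP[s0 _]; apply: clipped_generator_lip => y; exact: UU'.
Qed.

(** The successive images of the constant curve [f] converge geometrically at
    each time and vertex. The limit [L] is again Lipschitz in time, and its
    image [V] is within [O(2^-n)] of [L], hence equal to it for nonnegative
    times. *)
Lemma picard_fixed_point f : exists V, picard_image f V V.
Proof.
have step (U : {U | time_lipschitz U}) :
    exists V : {V | time_lipschitz V}, picard_image f (sval U) (sval V).
  case: U => U lU; have [V UV] := picard_image_exists f U lU.
  by exists (exist _ V (picard_image_lipschitz _ _ _ UV)).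
have [Phi PhiP] := choice step.
have l0 : time_lipschitz (fun=> f).
  by move=> x s t _ _; rewrite subrr normr0 mulr_ge0.
pose U n := sval (iter n Phi (exist _ _ l0)).
have US n : picard_image f (U n) (U n.+1) by exact: PhiP.
have UC n t x : 0 <= t -> `|U n.+1 t x - U n t x| <= expR (8 * t) * 2^-1 ^+ n.
  elim: n t x => [|n IH] t x t0.
    have -> : U 0%N t x = U 1%N 0 x by rewrite (US 0%N).1.
    have := picard_image_lipschitz _ _ _ (US 0%N) x t 0 t0 (lexx 0).
    rewrite subr0 (ger0_norm t0) expr0 mulr1.
    have := expR_ge1Dx (8 * t); lra.
  have := picard_contraction f (U n.+1) (U n) _ _ (2^-1 ^+ n) (US n.+1) (US n).
  have E : expR (8 * t) * 2^-1 ^+ n.+1 = 2^-1 ^+ n / 2 * expR (8 * t).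
    by rewrite exprSr mulrC.
  rewrite E; apply => // s y s0; rewrite mulrC; exact: IH.
have lim (p : R * G) : exists l, 0 <= p.1 ->
    forall n, `|l - U n p.1 p.2| <= 2 * expR (8 * p.1) * 2^-1 ^+ n.
  have [t0|] := boolP (0 <= p.1); last by exists 0.
  by have [l ?] := cauchy_geometric _ _ _ (fun n => UC n p.1 p.2 t0); exists l.
have [L' L'P] := choice lim; pose L t x := L' (t, x).
have LU n t x : 0 <= t -> `|L t x - U n t x| <= 2 * 2^-1 ^+ n * expR (8 * t).
  by move=> t0; have := L'P (t, x) t0 n; rewrite mulrAC.
have lL : time_lipschitz L.
  move=> x s t s0 t0.
  apply: (@le_add_geometric R _ _ (2 * expR (8 * s) + 2 * expR (8 * t))) => n.
  have := svalP (iter n Phi (exist _ _ l0)) x s t s0 t0; rewrite -/(U n).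
  have := LU n s x s0; have := LU n t x t0; rewrite !ler_norml.
  by move=> /andP[? ?] /andP[? ?] /andP[? ?]; apply/andP; split; lra.
have [V LV] := picard_image_exists f L lL.
have VL t : 0 <= t -> V t = L t.
  move=> t0; apply/funext => x; apply/eqP; rewrite -subr_eq0 -normr_le0.
  apply: (@le_add_geometric R _ _ (2 * expR (8 * t))) => n.
  have h1 := picard_contraction f L (U n) V (U n.+1) (2 * 2^-1 ^+ n) LV (US n)
    (LU n) t x t0.
  have := LU n.+1 t x t0; move: h1; rewrite exprS !ler_norml.
  by move=> /andP[? ?] /andP[? ?]; apply/andP; split; lra.
exists V; split; first exact: LV.1.
by move=> t x t0; rewrite VL //; exact: LV.2.
Qed.

(** The fixed point is differentiable at each vertex. It is differentiable in
    the sup norm because its derivative is Lipschitz in time with the same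
    constant [8] at all vertices, which makes the remainders quadratic in [h]
    uniformly. *)
Lemma clipped_flow_exists (f : linfty G R) : exists u : R -> linfty G R,
  [/\ u 0 = f, continuous u &
      forall t, 0 < t -> derivable u t 1 /\ derive1 u t = linfty_clipped (u t)].
Proof.
have [V VV] := picard_fixed_point f.
have lV := picard_image_lipschitz _ _ _ VV; have [V0 dV] := VV.
have ge0 (r : R) : 0 <= Num.max 0 r by rewrite le_max lexx.
have Vb t : V (Num.max 0 t) \in boundedf.
  apply/boundedfP; exists (`|f| + 2 * `|Num.max 0 t - 0|) => x.
  rewrite -(subrK (V 0 x) (V _ x)) addrC (le_trans (ler_normD _ _)) //.
  by rewrite lerD ?lV // V0 linfty_norm_ge.
(* Constant for negative times, so that continuity holds on the whole line. *)
pose u t : linfty G R := Linfty (Vb t).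
have uE (t : R) (x : G) : 0 <= t -> u t x = V t x by move=> t0; rewrite /= max_r.
have lu (s t : R) : 0 <= s -> 0 <= t -> `|u s - u t| <= 2 * `|s - t|.
  move=> s0 t0; apply: linfty_norm_le => [|x]; first by rewrite mulr_ge0.
  change (`|u s x - u t x| <= 2 * `|s - t|); rewrite !uE //; exact: lV.
exists u; split.
- by apply: linfty_eq => x; rewrite uE // V0.
- apply: (@locally_lipschitz_continuous _ _ _ _ (fun=> 2)) => s t _.
  have uM r : u r = u (Num.max 0 r).
    by apply: linfty_eq => x; rewrite /= (max_r (ge0 r)).
  rewrite uM (uM t) (le_trans (lu _ _ (ge0 s) (ge0 t))) // ler_pM2l //.
  exact: max0_contract.
move=> t t0; apply: (@derivable_of_quadratic_remainder _ _ _ _ t t 8) => // h ht.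
have th0 : 0 <= t + h by move: ht; rewrite ltr_norml => /andP[? _]; lra.
apply: linfty_norm_le => [|x]; first by rewrite mulr_ge0 // sqr_ge0.
change (`|u (t + h) x - u t x - h * clipped_generator (u t) x| <= 8 * h ^+ 2).
rewrite !uE ?(ltW t0) //.
have -> : (u t : G -> R) = V t by apply/funext => y; rewrite uE ?ltW.
set c := clipped_generator _ _.
have dpsi (s : R) : 0 <= s -> is_derive s 1 (fun s => V s x - c * s)
    (clipped_generator (V s) x - c).
  move=> s0; apply: is_deriveB; first exact: dV.
  by rewrite -[X in is_derive _ _ _ X]mulr1; exact: is_deriveZ.
have bnd (s : R) : 0 <= s -> `|s - t| <= `|h| ->
    `|clipped_generator (V s) x - c| <= 8 * `|h|.
  move=> s0 sh; apply: le_trans (clipped_generator_lip _ _ (2 * `|s - t|) x _) _.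
    by move=> y; apply: lV => //; exact: ltW.
  by lra.
have lin (s : R) : is_derive s 1 (fun r => 8 * `|h| * r) (8 * `|h|).
  by rewrite -[X in is_derive _ _ _ X]mulr1; exact: is_deriveZ.
have psi_le (a b : R) : 0 <= a -> a <= b ->
    (forall s, a <= s <= b -> `|s - t| <= `|h|) ->
    `|(V b x - c * b) - (V a x - c * a)| <= 8 * `|h| * b - 8 * `|h| * a.
  move=> a0 ab sh; apply: (@mean_value_le R (fun s => V s x - c * s)
    (fun r => 8 * `|h| * r) (fun s => clipped_generator (V s) x - c)
    (fun=> 8 * `|h|)) => // s sab; first by apply: dpsi; case/andP: sab => *; lra.
  by apply: bnd (sh s sab); case/andP: sab => *; lra.
have E : V (t + h) x - V t x - h * c =
    (V (t + h) x - c * (t + h)) - (V t x - c * t) by ring.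
rewrite E -(real_normK (num_real h)); have [h0|h0] := leP 0 h.
  apply: le_trans (psi_le t (t + h) (ltW t0) _ _) _; first by lra.
    move=> s /andP[? ?]; rewrite !ger0_norm; lra.
  by rewrite ger0_norm //; nra.
rewrite distrC; apply: le_trans (psi_le (t + h) t th0 _ _) _; first by lra.
  by move=> s /andP[? ?]; rewrite !ler0_norm; lra.
by rewrite ltr0_norm //; nra.
Qed.

End picard.

(** * The modified heat equation *)

Theorem theorem1p3 (R : realType) (G : weightedGraph R) (alpha K : R)
    (geomG : bounded_geometry G alpha) (K_ge0 : 0 <= K) (CDG : CD_infty G K)
    (u0 : linfty G R) (u0_small : `|linfty_Gamma u0| < alpha / 2) :
  exists u : R -> linfty G R,
    [/\ modified_heat_solution u,
        u 0 = u0,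
        (forall v : R -> linfty G R, modified_heat_solution v -> v 0 = u0 ->
           forall t : R, 0 <= t -> v t = u t) &
        (forall t : R, 0 <= t ->
           `|linfty_Gamma (u t)| <= expR (- 2 * K * t) * `|linfty_Gamma u0|)].
Proof.
have [u [u0E cu du]] := clipped_flow_exists u0.
have exp_le1 (t : R) : 0 <= t -> expR (- 2 * K * t) <= 1.
  move=> t0; rewrite -[leRHS]expR0 ler_expR !mulNr oppr_le0.
  by rewrite !mulr_ge0.
have small (v : R -> linfty G R) :
    (forall t : R, 0 <= t ->
      `|linfty_Gamma (v t)| <= expR (- 2 * K * t) * `|linfty_Gamma u0|) ->
    forall t : R, 0 < t ->
      linfty_clipped (v t) = linfty_Delta (v t) + linfty_Gamma (v t).
  move=> dec t t0; apply: linfty_clippedE geomG _; apply: le_lt_trans u0_small.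
  by rewrite (le_trans (dec t (ltW t0))) // ler_piMl // exp_le1 // ltW.
have cu' : {within `[0, +oo[, continuous u} by exact: continuous_subspaceT.
have decay_u : forall t : R, 0 <= t ->
    `|linfty_Gamma (u t)| <= expR (- 2 * K * t) * `|linfty_Gamma u0|.
  rewrite -u0E; apply: (Gamma_flow_decay _ _ _ geomG K_ge0 CDG cu').
    by rewrite u0E.
  move=> t t0 ut; have [d1 d2] := du t t0; split; rewrite // d2.
  exact: (linfty_clippedE alpha).
exists u; split => //.
- split=> //.
  + by move=> t t0; have [] := du t t0.
  + apply: (@subspace_eq_continuous _ _ _ (fun t => linfty_clipped (u t))).
      move=> t /set_mem /=; rewrite in_itv /= andbT => t0.
      by rewrite -(du t t0).2.
    apply: (continuous_subspaceT (f := fun t : R => linfty_clipped (u t))) => t.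
    exact: (continuous_comp (cu t) (linfty_clipped_continuous (u t))).
  + by move=> t t0; rewrite (du t t0).2 small.
- move=> v [cv dv _ v'E] v0 t t0.
  have decay_v : forall t : R, 0 <= t ->
      `|linfty_Gamma (v t)| <= expR (- 2 * K * t) * `|linfty_Gamma u0|.
    rewrite -v0; apply: (Gamma_flow_decay _ _ _ geomG K_ge0 CDG cv).
      by rewrite v0.
    by move=> s s0 _; split; [exact: dv|exact: v'E].
  apply: clipped_flow_unique => //; last by rewrite v0.
  by move=> s s0; split; [exact: dv|rewrite small // v'E].
Qed.
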